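(* There exists a free minimal action $\alpha$ of $\mathbb Z^2$ on the Cantor space $X$ such that the topological full group $[\![\alpha]\!]$ does not have any dense, locally finite subgroup.
   Context: $[\![\alpha]\!]$ is the group of homeomorphisms $g$ of $X$ for which there exist a clopen partition $X=\bigsqcup_{i=1}^n A_i$ and $\gamma_1,\dots,\gamma_n\in\mathbb Z^2$ with $g(x)=\alpha(\gamma_i)(x)$ for $x\in A_i$. $\mathrm{Homeo}(X)$ carries the topology whose basic identity neighbourhoods are the subgroups $\{g: gA=A\ \forall A\in\mathcal A\}$ for finite clopen partitions $\mathcal A$; density is with respect to the induced topology on $[\![\alpha]\!]$. *)

(* Defs.v *)
From HB Require Import structures.
From mathcomp Require Import all_boot all_order all_algebra.
From mathcomp Require Import all_classical all_reals topology cantor.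
Set Implicit Arguments. Unset Strict Implicit. Unset Printing Implicit Defensive.
Import Order.TTheory GRing.Theory Num.Theory.
Local Open Scope classical_set_scope.
Local Open Scope ring_scope.

Notation X := cantor_space.

Definition Z2 : Type := (int * int)%type.
Definition Z2add (a b : Z2) : Z2 := (a.1 + b.1, a.2 + b.2).
Definition Z2zero : Z2 := (0, 0).

Definition homeo (T : topologicalType) (g : T -> T) : Prop :=
  continuous g /\ exists h : T -> T, continuous h /\ cancel g h /\ cancel h g.

Definition Z2_action (alpha : Z2 -> X -> X) : Prop :=
  (forall g, homeo (alpha g)) /\
  alpha Z2zero = id /\
  (forall a b, alpha (Z2add a b) = alpha a \o alpha b).

Definition free_action (alpha : Z2 -> X -> X) : Prop :=
  forall (g : Z2) (x : X), alpha g x = x -> g = Z2zero.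

Definition minimal_action (alpha : Z2 -> X -> X) : Prop :=
  forall x : X, closure [set alpha g x | g in [set: Z2]] = [set: X].

Definition clopen_partition (n : nat) (A : nat -> set X) : Prop :=
  (forall i, (i < n)%N -> clopen (A i)) /\
  (forall i j, (i < n)%N -> (j < n)%N -> i <> j -> A i `&` A j = set0) /\
  (forall x : X, exists2 i, (i < n)%N & A i x).

Definition full_group (alpha : Z2 -> X -> X) : set (X -> X) :=
  [set g | homeo g /\
    exists n (A : nat -> set X) (gam : nat -> Z2),
      clopen_partition n A /\
      forall i, (i < n)%N -> forall x, A i x -> g x = alpha (gam i) x].

Definition is_subgroup (H : set (X -> X)) : Prop :=
  H id /\
  (forall f g, H f -> H g -> H (f \o g)) /\
  (forall f, H f -> exists2 g, H g & cancel f g /\ cancel g f).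

(* subgroup generated by s 0, ..., s (n-1) (where these are homeomorphisms) *)
Definition gen_subgroup (n : nat) (s : nat -> X -> X) : set (X -> X) :=
  [set f | forall K, is_subgroup K -> (forall i, (i < n)%N -> K (s i)) -> K f].

Definition locally_finite (H : set (X -> X)) : Prop :=
  forall n (s : nat -> X -> X), (forall i, (i < n)%N -> H (s i)) ->
    finite_set (gen_subgroup n s).

(* H is dense in [[alpha]] for the topology whose basic neighbourhoods of g
   are g U_A, U_A = {u | u A = A for all A in the partition}; note
   h \in g U_A  <->  h A = g A for all pieces A. *)
Definition dense_in_full_group (alpha : Z2 -> X -> X) (H : set (X -> X)) : Prop :=
  forall g, full_group alpha g ->
  forall n (A : nat -> set X), clopen_partition n A ->
  exists2 h, H h & forall i, (i < n)%N -> h @` A i = g @` A i.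

(* Main.v *)
(* The obstruction is 2-torsion in the coinvariants of the action (an example in
   the spirit of Matui).  Let Y be the Cantor minimal Z-system of the substitution
   1 -> 121211212, 2 -> 121221212, with the cocycle sending the letters 1, 2 to
   generators a, b of G = (Z/2)^2; Z^2 acts on Y x Y x G by the two shifts, both
   twisted by the cocycle.  Write [ij g] for the clopen set of points with letters
   i, j and label g.  Shifting in either direction gives, in the coinvariants,
     [1j g] + [2j g] = [1j g+a] + [2j g+b],  [i1 g] + [i2 g] = [i1 g+a] + [i2 g+b],
   whence 2 [12 a] = 2 [12 b].  If a locally finite subgroup were dense, elements
   h1, h2 of it would move the sets [ij g] as the two shifts do, so the finite group
   <h1, h2> would satisfy the same relations orbit by orbit: every orbit meets
   [12 a] and [12 b] equally often.  Choosing one point per orbit in a clopen way,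
   every Z/2-valued finitely additive invariant of the full group agrees on
   [12 a] and [12 b].  But counting modulo 2 over a suitable family of six tiles of
   level n, for n large, is such an invariant, and it separates them. *)

From HB Require Import structures.
Require Import Defs.
From mathcomp Require Import all_boot all_order all_algebra.
From mathcomp Require Import all_classical all_reals topology cantor.
From mathcomp Require Import zify Rstruct.
Set Implicit Arguments. Unset Strict Implicit. Unset Printing Implicit Defensive.
Local Open Scope classical_set_scope.

(* A path in the Bratteli diagram of the substitution: its initial letter (false for
   1, true for 2) and its edges.  [Some (i, _)] goes to the letter i through one of
   the four non-central positions of the letter in the image of i (so that its
   position is recovered in [digit]); [None] is the central position. *)
Definition edge : Type := option (bool * (bool * bool)).
Definition path1 : Type := (bool * (nat -> edge))%type.

(** * The substitution and desubstitution of paths *)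

Definition letter (d : nat) (i : bool) : bool :=
  nth true [:: false; true; false; true; i; false; true; false; true] d.

Definition edge_of (d : nat) (i : bool) : edge :=
  nth None [:: Some (i, (false, false)); Some (i, (false, false));
               Some (i, (false, true)); Some (i, (false, true)); None;
               Some (i, (true, false)); Some (i, (true, false));
               Some (i, (true, true)); Some (i, (true, true))] d.

(** [x] is read one level up, and [d] is the position of the new initial letter inside the image of
    [x.1]. *)
Definition prepend (d : nat) (x : path1) : path1 :=
  (letter d x.1, fun k => if k is k'.+1 then x.2 k' else edge_of d x.1).

(** The non-central positions form four pairs 01, 23, 56, 78, each spelling 12: the two bits name
    the pair, and the initial letter gives the place within it. *)
Definition digit (x : path1) : nat :=
  if x.2 0 is Some (_, (h, l)) then h * 5 + l * 2 + x.1 else 4.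

(** The central letter of the image of a letter is that letter, so a central edge leaves the head
    unchanged. *)
Definition tail (x : path1) : path1 :=
  (if x.2 0 is Some (i, _) then i else x.1, fun k => x.2 k.+1).

Lemma digit_lt9 x : digit x < 9.
Proof. by rewrite /digit; case: (x.2 0) => [[i [[] []]]|] //; case: x.1. Qed.

Lemma prepend_digit_tail x : prepend (digit x) (tail x) = x.
Proof.
case: x => i e; rewrite /prepend /digit /tail /=.
congr pair; first by case: (e 0) => [[j [[] []]]|] //; case: i.
by apply/funext => -[|k] //; case: (e 0) => [[j [[] []]]|] //; case: i.
Qed.

Lemma prependK d x : d < 9 -> digit (prepend d x) = d /\ tail (prepend d x) = x.
Proof. by case: x => i e; do 9 (case: d => [|d]; first by []). Qed.

Lemma digit_prepend d x : d < 9 -> digit (prepend d x) = d.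
Proof. by move/(prependK x) => []. Qed.

Lemma tail_prepend d x : d < 9 -> tail (prepend d x) = x.
Proof. by move/(prependK x) => []. Qed.

(** * Agreement to finite depth and the Vershik map *)

Definition agree1 n (x y : path1) : Prop :=
  x.1 = y.1 /\ forall k, k < n -> x.2 k = y.2 k.

Lemma agree1_sym n x y : agree1 n x y -> agree1 n y x.
Proof. by move=> [H1 H2]; split => // k /H2. Qed.

Lemma agree1_trans n x y z : agree1 n x y -> agree1 n y z -> agree1 n x z.
Proof. by move=> [a b] [c d]; split; [rewrite a | move=> k kn; rewrite b ?d]. Qed.

Lemma agree1_le m n x y : m <= n -> agree1 n x y -> agree1 m x y.
Proof. by move=> mn [H1 H2]; split => // k km; apply: H2; apply: leq_trans mn. Qed.

Lemma agree1_eq x y : (forall n, agree1 n x y) -> x = y.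
Proof.
case: x y => i e [j f] H; congr pair; first by case: (H 0).
by apply/funext => k; case: (H k.+1) => _; apply.
Qed.

Lemma agree1_prepend n d x y : agree1 n x y -> agree1 n.+1 (prepend d x) (prepend d y).
Proof.
move=> [H1 H2]; split; first by rewrite /= H1.
by move=> [|k] /= kn; [rewrite H1 | apply: H2].
Qed.

Lemma agree1S n x y : agree1 n.+1 x y -> digit x = digit y /\ agree1 n (tail x) (tail y).
Proof.
move=> [H1 H2]; rewrite /digit /tail H1 H2 //; split => //; split => //= k kn.
exact: H2.
Qed.

(* [vsucc] is the Vershik map: add one to the digits [digit (tail^k x)], carrying
   to the right; its defining equation is [vsuccE]. *)
Definition succ_head (x : path1) : bool :=
  (digit x < 8) && letter (digit x).+1 (tail x).1.

(** The recursion is on the depth [k]. After a carry, the edge at the new digit 0 needs the letter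
    above it; [succ_head] supplies that letter without following a further carry, since every image
    begins with 1. *)
Fixpoint succ_edge (k : nat) (x : path1) : edge :=
  if digit x < 8 then (prepend (digit x).+1 (tail x)).2 k
  else if k is k'.+1 then succ_edge k' (tail x) else edge_of 0 (succ_head (tail x)).

Definition vsucc (x : path1) : path1 := (succ_head x, succ_edge^~ x).
Arguments vsucc : simpl never.

Lemma vsuccE x : vsucc x =
  if digit x < 8 then prepend (digit x).+1 (tail x) else prepend 0 (vsucc (tail x)).
Proof.
case: ifP => dx.
  rewrite /vsucc /succ_head dx; congr pair; apply/funext => k.
  by case: k => [|k] /=; rewrite dx.
rewrite /vsucc /succ_head dx; congr pair; apply/funext => k.
by case: k => [|k] /=; rewrite dx.
Qed.

(** After a borrow the digit is 8, and every image ends in 2. *)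
Definition pred_head (x : path1) : bool :=
  (digit x == 0) || letter (digit x).-1 (tail x).1.

Fixpoint pred_edge (k : nat) (x : path1) : edge :=
  if digit x != 0 then (prepend (digit x).-1 (tail x)).2 k
  else if k is k'.+1 then pred_edge k' (tail x) else edge_of 8 (pred_head (tail x)).

Definition vpred (x : path1) : path1 := (pred_head x, pred_edge^~ x).
Arguments vpred : simpl never.

Lemma vpredE x : vpred x =
  if digit x != 0 then prepend (digit x).-1 (tail x) else prepend 8 (vpred (tail x)).
Proof.
case: (eqVneq (digit x) 0) => dx /=.
  rewrite /vpred /pred_head dx; congr pair; apply/funext => k.
  by case: k => [|k] /=; rewrite dx.
rewrite /vpred /pred_head (negPf dx); congr pair; apply/funext => k.
by case: k => [|k] /=; rewrite dx.
Qed.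

Lemma vsucc_prepend d x : d < 8 -> vsucc (prepend d x) = prepend d.+1 x.
Proof.
move=> d8; have d9 : d < 9 := ltnW d8.
by rewrite vsuccE digit_prepend ?tail_prepend // d8.
Qed.

Lemma vsucc_prepend8 x : vsucc (prepend 8 x) = prepend 0 (vsucc x).
Proof. by rewrite vsuccE digit_prepend ?tail_prepend. Qed.

Lemma vpred_prepend d x : d < 8 -> vpred (prepend d.+1 x) = prepend d x.
Proof. by move=> d8; rewrite vpredE digit_prepend ?tail_prepend. Qed.

Lemma vpred_prepend0 x : vpred (prepend 0 x) = prepend 8 (vpred x).
Proof. by rewrite vpredE digit_prepend ?tail_prepend. Qed.

(** A carry may run forever, so the identity is proved at each finite depth; every induction step
    resolves one more digit. *)
Lemma vsuccK : cancel vsucc vpred.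
Proof.
move=> x; apply: agree1_eq => n; elim: n x => [|n IH] x;
  rewrite -[x]prepend_digit_tail; have := digit_lt9 x;
  rewrite ltnS leq_eqVlt => /predU1P[->|d8].
- by rewrite vsucc_prepend8 vpred_prepend0.
- by rewrite vsucc_prepend // vpred_prepend.
- by rewrite vsucc_prepend8 vpred_prepend0; apply: agree1_prepend.
- by rewrite vsucc_prepend // vpred_prepend.
Qed.

Lemma vpredK : cancel vpred vsucc.
Proof.
move=> x; apply: agree1_eq => n; elim: n x => [|n IH] x;
  rewrite -[x]prepend_digit_tail; have := digit_lt9 x;
  case: (digit x) => [|d] d8.
- by rewrite vpred_prepend0 vsucc_prepend8.
- by rewrite vpred_prepend // vsucc_prepend.
- by rewrite vpred_prepend0 vsucc_prepend8; apply: agree1_prepend.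
- by rewrite vpred_prepend // vsucc_prepend.
Qed.

(** Continuity holds even at the path with all digits 8, because a carry puts the letter 1 in front
    whatever follows. One level is lost because the digit is read off the first edge. *)
Lemma agree1_vsucc n x y : agree1 n.+1 x y -> agree1 n (vsucc x) (vsucc y).
Proof.
elim: n x y => [|n IH] x y /agree1S[dxy txy]; rewrite (vsuccE x) (vsuccE y) dxy; case: ifP => _.
- exact/agree1_le/agree1_prepend/txy.
- by [].
- exact/agree1_le/agree1_prepend/txy.
- by apply: agree1_prepend; apply: IH.
Qed.

Lemma agree1_vpred n x y : agree1 n.+1 x y -> agree1 n (vpred x) (vpred y).
Proof.
elim: n x y => [|n IH] x y /agree1S[dxy txy]; rewrite (vpredE x) (vpredE y) dxy; case: ifP => _.
- exact/agree1_le/agree1_prepend/txy.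
- by [].
- exact/agree1_le/agree1_prepend/txy.
- by apply: agree1_prepend; apply: IH.
Qed.

(** * The action *)

Definition ziter (T : Type) (f g : T -> T) (m : int) : T -> T :=
  match m with Posz n => iter n f | Negz n => iter n.+1 g end.

Section Ziter.
Variables (T : Type) (f g : T -> T).
Hypotheses (fK : cancel f g) (gK : cancel g f).

Lemma ziter_succ (m : int) t : ziter f g (m + 1)%R t = f (ziter f g m t).
Proof.
case: m => [n|[|n]].
- have -> : (Posz n + 1 = n.+1%:Z)%R by lia.
  by [].
- have -> : (Negz 0 + 1 = 0%:Z)%R by lia.
  by rewrite /= gK.
- have -> : (Negz n.+1 + 1 = Negz n)%R by lia.
  by rewrite /= gK.
Qed.

Lemma ziter_pred (m : int) t : ziter f g (m - 1)%R t = g (ziter f g m t).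
Proof.
have -> : ziter f g m t = f (ziter f g (m - 1)%R t).
  by rewrite -ziter_succ GRing.subrK.
by rewrite fK.
Qed.

Lemma ziterD (m n : int) t : ziter f g (m + n)%R t = ziter f g m (ziter f g n t).
Proof.
elim/int_rec: m t => [|m IH|m IH] t; first by rewrite GRing.add0r.
  have -> : (m.+1%:Z + n)%R = (m%:Z + n + 1)%R by lia.
  have -> : m.+1%:Z%R = (m%:Z + 1)%R by lia.
  by rewrite !ziter_succ IH.
have -> : (- m.+1%:Z + n)%R = (- m%:Z + n - 1)%R by lia.
have -> : (- m.+1%:Z)%R = (- m%:Z - 1)%R by lia.
by rewrite !ziter_pred IH.
Qed.

Lemma ziter_comm (h : T -> T) : (forall t, f (h t) = h (f t)) ->
  forall m t, ziter f g m (h t) = h (ziter f g m t).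
Proof.
move=> fh m t.
have gh u : g (h u) = h (g u) by rewrite -[in LHS](gK u) -fh fK.
by case: m => n /=; [elim: n | rewrite -!iterS; elim: n.+1] => //= k ->.
Qed.

End Ziter.

(** * The skew product by (Z/2)^2 *)

Definition label : Type := (bool * bool)%type.

Definition ladd (g h : label) : label := (g.1 (+) h.1, g.2 (+) h.2).

Lemma laddA g h k : ladd g (ladd h k) = ladd (ladd g h) k.
Proof. by rewrite /ladd /= !addbA. Qed.

Lemma laddC g h : ladd g h = ladd h g.
Proof. by rewrite /ladd addbC [X in (_, X)]addbC. Qed.

Lemma laddAC g h k : ladd (ladd g h) k = ladd (ladd g k) h.
Proof. by rewrite -!laddA [ladd h k]laddC. Qed.

Lemma laddK h g : ladd (ladd g h) h = g.
Proof. by case: g => a b; rewrite /ladd /= !addbK. Qed.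

Lemma ladd0 g : ladd g (false, false) = g.
Proof. by case: g => a b; rewrite /ladd /= !addbF. Qed.

(** The generators a = (1,0) and b = (0,1), for the letters 1 and 2. *)
Definition charge (i : bool) : label := (~~ i, i).

(* The total charge of the first [d] letters of the image of [i]. *)
Fixpoint drift (d : nat) (i : bool) : label :=
  if d is d'.+1 then ladd (drift d' i) (charge (letter d' i)) else (false, false).

Definition skew_space : Type := (path1 * path1 * label)%type.

(** The cocycle adds the charge of the letter being left, so [west] must add the charge of the
    letter it arrives at. *)
Definition east (t : skew_space) : skew_space :=
  (vsucc t.1.1, t.1.2, ladd t.2 (charge t.1.1.1)).
Definition west (t : skew_space) : skew_space :=
  (vpred t.1.1, t.1.2, ladd t.2 (charge (vpred t.1.1).1)).
Definition swap (t : skew_space) : skew_space := (t.1.2, t.1.1, t.2).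
Definition north (t : skew_space) : skew_space := swap (east (swap t)).
Definition south (t : skew_space) : skew_space := swap (west (swap t)).

Lemma swapK : involutive swap. Proof. by move=> [[]]. Qed.

Lemma eastK : cancel east west.
Proof. by move=> [[x y] g]; rewrite /west /east; cbn [fst snd]; rewrite vsuccK laddK. Qed.

Lemma westK : cancel west east.
Proof. by move=> [[x y] g]; rewrite /west /east; cbn [fst snd]; rewrite vpredK laddK. Qed.

Lemma northK : cancel north south.
Proof. by move=> t; rewrite /north /south swapK eastK swapK. Qed.

Lemma southK : cancel south north.
Proof. by move=> t; rewrite /north /south swapK westK swapK. Qed.

Lemma east_north t : east (north t) = north (east t).
Proof. by case: t => [[x y] g]; rewrite /north /east /= laddAC. Qed.

Definition act (v : Z2) (t : skew_space) : skew_space :=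
  ziter east west v.1 (ziter north south v.2 t).

Lemma ziter_east_north m n t :
  ziter east west m (ziter north south n t) = ziter north south n (ziter east west m t).
Proof.
apply: (ziter_comm eastK westK) => u.
by rewrite (ziter_comm northK southK) // => w; rewrite east_north.
Qed.

Lemma actD v w t : act (Z2add v w) t = act v (act w t).
Proof.
rewrite /act /= (ziterD eastK westK) (ziterD northK southK).
by congr ziter; rewrite ziter_east_north.
Qed.

Lemma act0 t : act Z2zero t = t. Proof. by []. Qed.

Lemma actNK v : cancel (act v) (act (- v.1, - v.2)%R).
Proof.
by move=> t; rewrite -actD /Z2add /= !GRing.addNr act0.
Qed.

Lemma actKN v : cancel (act (- v.1, - v.2)%R) (act v).
Proof.
by move=> t; rewrite -actD /Z2add /= !GRing.addrN act0.
Qed.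

(* Blowing up one level of the substitution conjugates [act v] to [act (9 v)]. *)
Definition blow (t : skew_space) : skew_space := (prepend 0 t.1.1, prepend 0 t.1.2, t.2).

(** For d, e < 9, the point d steps east and e steps north of [blow t]; the drifts are the charges
    collected on the way. *)
Definition place (d e : nat) (t : skew_space) : skew_space :=
  (prepend d t.1.1, prepend e t.1.2,
   ladd (ladd t.2 (drift d t.1.1.1)) (drift e t.1.2.1)).

Lemma iter_east_prepend d x y g : d < 9 ->
  iter d east (prepend 0 x, y, g) = (prepend d x, y, ladd g (drift d x.1)).
Proof.
elim: d => [|d IH] d9 /=; first by rewrite ladd0.
by rewrite IH ?(ltnW d9) // /east [t in (t, _, _)]/= vsucc_prepend // laddA.
Qed.

Lemma iter_swap d t : iter d north t = swap (iter d east (swap t)).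
Proof. by elim: d => [|d IH] /=; rewrite ?swapK // IH /north swapK. Qed.

Lemma act_blow (d e : nat) t : d < 9 -> e < 9 -> act (d%:Z, e%:Z)%R (blow t) = place d e t.
Proof.
move=> d9 e9; case: t => [[x y] g].
rewrite /act /blow /= iter_swap /swap /= iter_east_prepend // /=.
by rewrite iter_east_prepend //= /place laddAC.
Qed.

(** The image of 1 has five 1s and four 2s, that of 2 four 1s and five 2s; so modulo 2 the total
    charge of an image is the charge of its letter. This makes the blow-up equivariant. *)
Lemma iter9_east x y g :
  iter 9 east (prepend 0 x, y, g) = (prepend 0 (vsucc x), y, ladd g (charge x.1)).
Proof.
rewrite iterS iter_east_prepend // /east [t in (t, _, _)]/= vsucc_prepend8 -laddA.
congr (_, _, ladd _ _).
by case: x.1.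
Qed.

Lemma east9_blow t : iter 9 east (blow t) = blow (east t).
Proof. by case: t => [[x y] g]; exact: iter9_east. Qed.

Lemma north9_blow t : iter 9 north (blow t) = blow (north t).
Proof. by rewrite iter_swap; rewrite -[swap (blow t)]/(blow (swap t)) east9_blow. Qed.

Lemma ziter9_blow (f g : skew_space -> skew_space) : cancel f g -> cancel g f ->
  (forall t, iter 9 f (blow t) = blow (f t)) ->
  forall m t, ziter f g (9 * m)%R (blow t) = blow (ziter f g m t).
Proof.
move=> fK gK f9 m t.
elim/int_rec: m t => [|m IH|m IH] t; first by rewrite GRing.mulr0.
- have -> : (9 * m.+1%:Z = 9%:Z + 9 * m%:Z)%R by lia.
  by rewrite (ziterD fK gK) IH /= -f9.
- have -> : (9 * - m.+1%:Z = (- 9%:Z) + 9 * - m%:Z)%R by lia.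
  rewrite (ziterD fK gK) IH.
  have -> : (- m.+1%:Z)%R = (- m%:Z - 1)%R by lia.
  rewrite (ziter_pred fK gK).
  set u := ziter f g _ t; rewrite -{1}(gK u) -f9.
  rewrite -[iter 9 f _]/(ziter f g 9%:Z _) -(ziterD fK gK).
  by rewrite GRing.addNr.
Qed.

Lemma act9_blow v t : act (9 * v.1, 9 * v.2)%R (blow t) = blow (act v t).
Proof.
rewrite /act /= (ziter9_blow northK southK); last exact: north9_blow.
by rewrite (ziter9_blow eastK westK) //; exact: east9_blow.
Qed.

(** Undoes [place] at the digits of [t]: labels have order 2, so adding the drifts again removes
    them. *)
Definition shrink (t : skew_space) : skew_space :=
  (tail t.1.1, tail t.1.2,
   ladd (ladd t.2 (drift (digit t.1.1) (tail t.1.1).1))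
        (drift (digit t.1.2) (tail t.1.2).1)).

Definition digits (t : skew_space) : Z2 := ((digit t.1.1)%:Z, (digit t.1.2)%:Z)%R.

Lemma place_shrink t : place (digit t.1.1) (digit t.1.2) (shrink t) = t.
Proof.
case: t => [[x y] g]; rewrite /place /= !prepend_digit_tail.
by rewrite laddAC laddK laddK.
Qed.

Lemma act_digits_blow t : act (digits t) (blow (shrink t)) = t.
Proof. by rewrite act_blow ?digit_lt9 // place_shrink. Qed.

Lemma shrink_place d e t : d < 9 -> e < 9 -> shrink (place d e t) = t.
Proof.
move=> d9 e9; case: t => [[x y] g].
rewrite /shrink /place; cbn [fst snd].
rewrite !digit_prepend // !tail_prepend //.
by rewrite laddAC laddK laddK.
Qed.

(** Descent: if [v] fixes [t], comparing digits shows v = 9 q, where [q] fixes [shrink t] and is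
    shorter than [v] unless v = 0. *)
Lemma act_free v t : act v t = t -> v = Z2zero.
Proof.
have [n] := ubnP (`|v.1| + `|v.2|)%N.
elim: n v t => // n IH [m k] t /= hv fixt.
(* The position of [act v t] relative to the corner [blow (shrink t)], to be divided by 9 with
   remainder. *)
pose a := (m + (digits t).1)%R; pose b := (k + (digits t).2)%R.
have : act (a, b) (blow (shrink t)) = t.
  by rewrite -[(a, b)]/(Z2add (m, k) (digits t)) actD act_digits_blow.
pose d := `|(a %% 9)%Z|%N; pose e := `|(b %% 9)%Z|%N.
pose q := ((a %/ 9)%Z, (b %/ 9)%Z).
have d9 : (d < 9)%N by rewrite /d; lia.
have e9 : (e < 9)%N by rewrite /e; lia.
have -> : (a, b) = Z2add (d%:Z, e%:Z)%R (9 * q.1, 9 * q.2)%R.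
  by rewrite /Z2add /q /d /e /=; congr pair; lia.
rewrite actD act9_blow act_blow // => tE.
have sE : shrink t = act q (shrink t) by rewrite -{1}tE shrink_place.
have dE : digit t.1.1 = d by rewrite -tE digit_prepend.
have eE : digit t.1.2 = e by rewrite -tE digit_prepend.
have mE : m = (9 * q.1)%R by move: (dE); rewrite /q /d /a /digits /=; lia.
have kE : k = (9 * q.2)%R by move: (eE); rewrite /q /e /b /digits /=; lia.
have [z|nz] := eqVneq (`|m| + `|k|)%N 0%N.
  by congr pair; lia.
have qz : q = Z2zero by apply: IH (esym sE); lia.
by rewrite mE kE qz.
Qed.

(** * Continuity of the action and density of orbits *)

Definition agree n (t u : skew_space) : Prop :=
  [/\ agree1 n t.1.1 u.1.1, agree1 n t.1.2 u.1.2 & t.2 = u.2].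

Lemma agree_sym n t u : agree n t u -> agree n u t.
Proof. by move=> [/agree1_sym a /agree1_sym b c]. Qed.

Lemma agree_trans n t u v : agree n t u -> agree n u v -> agree n t v.
Proof.
move=> [a b c] [a' b' c']; split; last by rewrite c.
  exact: agree1_trans a a'.
exact: agree1_trans b b'.
Qed.

Lemma agree_le m n t u : m <= n -> agree n t u -> agree m t u.
Proof. by move=> mn [/(agree1_le mn) a /(agree1_le mn) b c]. Qed.

Lemma agree_eq t u : (forall n, agree n t u) -> t = u.
Proof.
case: t u => [[x y] g] [[x' y'] g'] H; congr (_, _, _).
- by apply: agree1_eq => n; case: (H n).
- by apply: agree1_eq => n; case: (H n).
- by case: (H 0).
Qed.

Lemma agree_swap n t u : agree n t u -> agree n (swap t) (swap u).
Proof. by move=> []. Qed.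

Lemma agree_east n t u : agree n.+1 t u -> agree n (east t) (east u).
Proof.
move=> [a b c]; split.
- exact: agree1_vsucc.
- exact: agree1_le b.
- by rewrite /= c; case: a => ->.
Qed.

Lemma agree_west n t u : agree n.+1 t u -> agree n (west t) (west u).
Proof.
move=> [/agree1_vpred a b c]; split => //.
- exact: agree1_le b.
- by rewrite /west; cbn [snd fst]; rewrite c; case: a => ->.
Qed.

Lemma agree_iter (f : skew_space -> skew_space) :
  (forall n t u, agree n.+1 t u -> agree n (f t) (f u)) ->
  forall k n t u, agree (k + n) t u -> agree n (iter k f t) (iter k f u).
Proof.
move=> fP; elim=> [|k IH] n t u //= tu.
by apply: fP; apply: IH; rewrite addnS.
Qed.

Lemma agree_act v n t u :
  agree (`|v.1| + (`|v.2| + n)) t u -> agree n (act v t) (act v u).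
Proof.
have Hn n' t' u' : agree n'.+1 t' u' -> agree n' (north t') (north u').
  by move=> H; apply/agree_swap/agree_east/agree_swap.
have Hs n' t' u' : agree n'.+1 t' u' -> agree n' (south t') (south u').
  by move=> H; apply/agree_swap/agree_west/agree_swap.
move=> tu; rewrite /act.
have : agree (`|v.1| + n) (ziter north south v.2 t) (ziter north south v.2 u).
  by case: v.2 tu => k tu; apply: agree_iter => //; rewrite addnCA; apply: agree_le tu; lia.
by case: v.1 {tu} => k tu; apply: agree_iter; rewrite ?NegzE //;
  [exact: agree_east | exact: agree_west].
Qed.

Lemma agree_place n d e t u : agree n t u -> agree n.+1 (place d e t) (place d e u).
Proof.
move=> [a b c]; split; try exact: agree1_prepend.
by rewrite /= c; case: a => -> _; case: b => -> _.
Qed.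

Lemma agree_act_blow n d e t u : d < 9 -> e < 9 -> agree n t u ->
  agree n.+1 (act (d%:Z, e%:Z)%R (blow t)) (act (d%:Z, e%:Z)%R (blow u)).
Proof. by move=> d9 e9 tu; rewrite !act_blow //; exact: agree_place. Qed.

(** The nine positions of an image realize all eight pairs of a letter and an accumulated charge.
    This is why the twisted action remains minimal. *)
Lemma letter_drift_surj (i l : bool) (g : label) :
  exists2 d, d < 9 & letter d i = l /\ drift d i = g.
Proof.
exists (find (fun d => (letter d i == l) && (drift d i == g)) (iota 0 9)).
  by case: i; case: l; case: g => [[] []].
by case: i; case: l; case: g => [[] []].
Qed.

Lemma act_from_blow d e w t : exists v,
  act v t = act (d%:Z, e%:Z)%R (blow (act w (shrink t))).
Proof.
exists (Z2add (Z2add (d%:Z, e%:Z)%R (9 * w.1, 9 * w.2)%R)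
           (- (digits t).1, - (digits t).2)%R).
by rewrite !actD -{3}(act_digits_blow t) actNK act9_blow.
Qed.

(** Align the desubstituted points to depth n, then choose the digits of [u]. At depth 0, [e] has
    drift zero and [d] makes up the difference of the labels. *)
Lemma act_dense n t u : exists v, agree n (act v t) u.
Proof.
elim: n t u => [|n IH] t u.
  have [e e9 [le de]] := letter_drift_surj (shrink t).1.2.1 u.1.2.1 (false, false).
  have [d d9 [ld dd]] := letter_drift_surj (shrink t).1.1.1 u.1.1.1
    (ladd (shrink t).2 u.2).
  have [v vE] := act_from_blow d e Z2zero t; exists v; rewrite vE act0 act_blow //.
  split => //=; rewrite dd de ladd0.
  by rewrite laddA /ladd /= !addbb; case: (u.2).
have [w H] := IH (shrink t) (shrink u).
have [v vE] := act_from_blow (digit u.1.1) (digit u.1.2) w t; exists v.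
rewrite vE -[u in agree _ _ u]act_digits_blow.
by apply: agree_act_blow; rewrite ?digit_lt9.
Qed.

(** * States and tiles of level n *)

Definition state : Type := (bool * bool * label)%type.
Definition state_of (t : skew_space) : state := (t.1.1.1, t.1.2.1, t.2).
(** A representative of each state; central edges throughout repeat its two letters at every
    level. *)
Definition point_of (q : state) : skew_space := ((q.1.1, fun=> None), (q.1.2, fun=> None), q.2).

Lemma agree0 t u : agree 0 t u <-> state_of t = state_of u.
Proof.
case: t u => [[[i e] [j f]] g] [[[i' e'] [j' f']] g']; split.
  by move=> [[/= -> _] [/= -> _] /= ->].
by move=> [-> -> ->]; split; split.
Qed.

Lemma state_of_point q : state_of (point_of q) = q.
Proof. by case: q => [[]]. Qed.

Lemma act_scale n v t :
  act ((9 ^ n)%:Z * v.1, (9 ^ n)%:Z * v.2)%R (iter n blow t) = iter n blow (act v t).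
Proof.
elim: n => [|n IH]; first by rewrite expn0 !GRing.mul1r; case: v.
rewrite !iterS -IH -act9_blow /=.
by congr act; congr pair; rewrite expnS PoszM GRing.mulrA.
Qed.

(** The points at offsets below 9^n from the corner [iter n blow t] form a tile of level n. To depth
    n they depend only on the state of [t]: the last base-9 digits of D and E fix the first
    position, and the quotients act one level up. *)
Lemma agree_tile n D E t u : D < 9 ^ n -> E < 9 ^ n -> agree 0 t u ->
  agree n (act (D%:Z, E%:Z)%R (iter n blow t)) (act (D%:Z, E%:Z)%R (iter n blow u)).
Proof.
move=> + + tu; elim: n D E => [|n IH] D E.
  by rewrite expn0 !ltnS !leqn0 => /eqP -> /eqP ->.
rewrite expnS => D9 E9.
have -> : (D%:Z, E%:Z)%R = Z2add ((D %% 9)%:Z, (E %% 9)%:Z)%R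
   (9 * (D %/ 9)%:Z, 9 * (E %/ 9)%:Z)%R by rewrite /Z2add /=; congr pair; lia.
rewrite !actD !iterS !(act9_blow ((D %/ 9)%:Z, (E %/ 9)%:Z)%R).
by apply: agree_act_blow; rewrite ?ltn_mod //; apply: IH; rewrite ltn_divLR // mulnC.
Qed.

Lemma act_split n (D d E e : nat) t : d < 9 -> e < 9 ->
  act ((9 ^ n * d + D)%:Z, (9 ^ n * e + E)%:Z)%R (iter n.+1 blow t)
  = act (D%:Z, E%:Z)%R (iter n blow (place d e t)).
Proof.
move=> d9 e9; rewrite iterSr -act_blow // -act_scale -actD.
by congr act; rewrite /Z2add /=; congr pair; lia.
Qed.

(** * The parity invariant *)

Definition level n (T : Type) (f : skew_space -> T) : Prop :=
  forall t u, agree n t u -> f t = f u.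

Lemma level_le m n T (f : skew_space -> T) : m <= n -> level m f -> level n f.
Proof. by move=> mn Hf t u /(agree_le mn); exact: Hf. Qed.

Lemma level_tile n T (f : skew_space -> T) D E t : level n f -> D < 9 ^ n -> E < 9 ^ n ->
  f (act (D%:Z, E%:Z)%R (iter n blow t)) =
  f (act (D%:Z, E%:Z)%R (iter n blow (point_of (state_of t)))).
Proof. by move=> lf Dn En; apply: lf; apply: agree_tile. Qed.

(** Over Z/2 only parities of multiplicities matter, which turns identities for all [F] into checks
    over the 16 states. *)
Lemma xor_count (L : seq state) (F : state -> bool) :
  \big[addb/false]_(q <- L) F q =
  \big[addb/false]_(q : state) (odd (count_mem q L) && F q).
Proof.
elim: L => [|a L IH]; first by rewrite big_nil big1.
rewrite big_cons IH.
under [RHS]eq_bigr => q _ do rewrite /= oddD andb_addl.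
rewrite big_split /=; congr addb.
by rewrite (bigD1 a) //= eqxx big1 ?addbF // => q /negPf qa; rewrite eq_sym qa.
Qed.

Lemma xor_parity (L M : seq state) (F : state -> bool) :
  (forall q, odd (count_mem q L) = odd (count_mem q M)) ->
  \big[addb/false]_(q <- L) F q = \big[addb/false]_(q <- M) F q.
Proof. by move=> H; rewrite (xor_count L) (xor_count M); apply: eq_bigr => q _; rewrite H. Qed.

(* The six corner states (i, j, g) of the tiles to be counted: g_a = 1 for (1,1),
   g_b = 1 for (1,2) and (2,1).  Along every edge of these tiles the labels match up
   modulo 2, so that the boundary terms cancel in [tile_parity_east]. *)
Definition seeds : seq state :=
  [:: (false, false, (true, false)); (false, false, (true, true));
      (false, true, (false, true)); (false, true, (true, true));
      (true, false, (false, true)); (true, false, (true, true))].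

(** Cutting each of the six tiles into its 81 subtiles reproduces the same six states modulo 2. *)
Lemma seeds_refine (F : state -> bool) :
  \big[addb/false]_(q <- seeds) \big[addb/false]_(0 <= d < 9)
    \big[addb/false]_(0 <= e < 9) F (state_of (place d e (point_of q)))
  = \big[addb/false]_(q <- seeds) F q.
Proof.
transitivity (\big[addb/false]_(q <- [seq state_of (place p.1 p.2 (point_of q)) |
   q <- seeds, p <- [seq (d, e) | d <- index_iota 0 9, e <- index_iota 0 9]]) F q).
  by rewrite big_allpairs_dep; apply: eq_bigr => q _; rewrite big_allpairs_dep.
by apply: xor_parity => -[[[] []] [[] []]]; vm_compute.
Qed.

(** Every image begins with 1, so a first column depends only on the vertical letter and the label.
    Adding the charge of the horizontal letter to the labels of the seeds preserves these pairs
    modulo 2. *)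
Lemma seeds_east (F : state -> bool) :
  \big[addb/false]_(q <- seeds) \big[addb/false]_(0 <= e < 9)
    F (state_of (place 0 e (east (point_of q))))
  = \big[addb/false]_(q <- seeds) \big[addb/false]_(0 <= e < 9)
    F (state_of (place 0 e (point_of q))).
Proof.
rewrite -(big_allpairs_dep (h := fun q e => state_of (place 0 e (east (point_of q))))).
rewrite -(big_allpairs_dep (h := fun q e => state_of (place 0 e (point_of q)))).
by apply: xor_parity => -[[[] []] [[] []]]; vm_compute.
Qed.

Lemma big_nat_blocks (m k : nat) (F : nat -> bool) :
  \big[addb/false]_(0 <= D < k * m) F D =
  \big[addb/false]_(0 <= d < m) \big[addb/false]_(0 <= D < k) F (k * d + D)%N.
Proof.
elim: m => [|m IH]; first by rewrite muln0 !big_geq.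
rewrite big_nat_recr //= -IH mulnS addnC (@big_cat_nat _ _ _ (k * m)) ?leq_addr //=.
congr addb; rewrite -{1}[(k * m)%N]add0n big_addn addKn.
by apply: eq_bigr => i _; rewrite addnC.
Qed.

Lemma big_nat_telescope (N : nat) (F : nat -> bool) :
  \big[addb/false]_(0 <= D < N) F D.+1 =
  \big[addb/false]_(0 <= D < N) F D (+) (F 0 (+) F N).
Proof.
elim: N => [|N IH]; first by rewrite !big_geq // addbb.
rewrite !big_nat_recr //= IH.
by case: (F 0); case: (F N); case: (F N.+1); case: (\big[_/_]_(_ <= _ < _) _).
Qed.

Definition tile_parity n (f : skew_space -> bool) : bool :=
  \big[addb/false]_(q <- seeds) \big[addb/false]_(0 <= D < 9 ^ n)
    \big[addb/false]_(0 <= E < 9 ^ n)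
      f (act (D%:Z, E%:Z)%R (iter n blow (point_of q))).

(** The count stabilizes once [f] is determined at level n, by [seeds_refine] at each fixed offset
    inside the subtiles. *)
Lemma tile_parityS n f : level n f -> tile_parity n.+1 f = tile_parity n f.
Proof.
move=> lf; rewrite /tile_parity expnSr.
(* Each tile of level n+1 is cut into 81 tiles of level n, on which [f] is determined by the state
   at the corner. *)
under eq_bigr => q _.
  rewrite big_nat_blocks exchange_big.
  under eq_big_nat => D /andP[_ Dn].
    under eq_big_nat => d /andP[_ d9].
      rewrite big_nat_blocks exchange_big.
      under eq_big_nat => E /andP[_ En].
        under eq_big_nat => e /andP[_ e9] do rewrite act_split // (level_tile _ lf) //.
        over.
      over.
    rewrite exchange_big; over.
  over.
rewrite exchange_big [RHS]exchange_big; apply: eq_bigr => D _.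
rewrite exchange_big [RHS]exchange_big; apply: eq_bigr => E _.
exact: (seeds_refine (fun q => f (act (D%:Z, E%:Z)%R (iter n blow (point_of q))))).
Qed.

Lemma act_split_col n (E e : nat) t : e < 9 ->
  act (0, (9 ^ n * e + E)%:Z)%R (iter n.+1 blow t)
  = act (0, E%:Z)%R (iter n blow (place 0 e t)).
Proof. by move=> e9; rewrite -act_split // muln0. Qed.

Lemma act_split_east n (E e : nat) t : e < 9 ->
  act ((9 ^ n.+1)%:Z, (9 ^ n * e + E)%:Z)%R (iter n.+1 blow t)
  = act (0, E%:Z)%R (iter n blow (place 0 e (east t))).
Proof.
move=> e9; rewrite -act_split // -[east t]/(act (1, 0)%R t) -act_scale -actD.
by congr act; rewrite /Z2add /=; congr pair; lia.
Qed.

(** Shifting a tile by one exchanges its first column for the column just beyond it. Both are cut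
    into columns of level-n tiles, hence the level n+1, and cancel by [seeds_east]. *)
Lemma tile_parity_east n f : level n f ->
  tile_parity n.+1 (f \o east) = tile_parity n.+1 f.
Proof.
move=> lf; rewrite /tile_parity.
pose F q D := \big[addb/false]_(0 <= E < 9 ^ n.+1)
  f (act (D%:Z, E%:Z)%R (iter n.+1 blow (point_of q))).
(* [act] applies the horizontal iterates last, so composing with [east] replaces D by D.+1 by
   computation. *)
transitivity (\big[addb/false]_(q <- seeds) \big[addb/false]_(0 <= D < 9 ^ n.+1) F q D.+1).
  by [].
under eq_bigr do rewrite big_nat_telescope.
rewrite big_split /= -[RHS]addbF; congr addb; rewrite big_split /=.
have -> : \big[addb/false]_(q <- seeds) F q (9 ^ n.+1) = \big[addb/false]_(q <- seeds) F q 0;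
  last by rewrite addbb.
rewrite /F.
under eq_bigr => q _.
  rewrite [X in index_iota 0 X]expnSr big_nat_blocks exchange_big.
  under eq_big_nat => E /andP[_ En].
    under eq_big_nat => e /andP[_ e9] do
      rewrite act_split_east // (level_tile _ lf) ?expn_gt0 //.
    over.
  over.
under [RHS]eq_bigr => q _.
  rewrite expnSr big_nat_blocks exchange_big.
  under eq_big_nat => E /andP[_ En].
    under eq_big_nat => e /andP[_ e9] do
      rewrite act_split_col // (level_tile _ lf) ?expn_gt0 //.
    over.
  over.
rewrite exchange_big [RHS]exchange_big; apply: eq_bigr => E _.
exact: (seeds_east (fun q => f (act (0, E%:Z)%R (iter n blow (point_of q))))).
Qed.

Lemma act_swap (D E : nat) t :
  swap (act (D%:Z, E%:Z)%R t) = act (E%:Z, D%:Z)%R (swap t).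
Proof.
have sn k u : swap (iter k north u) = iter k east (swap u) by rewrite iter_swap swapK.
have se k u : swap (iter k east u) = iter k north (swap u) by rewrite iter_swap swapK.
rewrite /act -[LHS]/(swap (iter D east (iter E north t))) se sn.
by rewrite -[RHS]/(act (E%:Z, D%:Z)%R (swap t)) /act ziter_east_north.
Qed.

(** The seeds are symmetric in the two letters; this reduces the vertical shift to the horizontal
    one. *)
Lemma tile_parity_swap n f : tile_parity n (f \o swap) = tile_parity n f.
Proof.
rewrite /tile_parity.
pose F q := \big[addb/false]_(0 <= D < 9 ^ n) \big[addb/false]_(0 <= E < 9 ^ n)
  f (act (D%:Z, E%:Z)%R (iter n blow (point_of q))).
pose flip (q : state) : state := (q.1.2, q.1.1, q.2).
transitivity (\big[addb/false]_(q <- map flip seeds) F q).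
  rewrite big_map; apply: eq_bigr => q _; rewrite exchange_big.
  apply: eq_bigr => E _; apply: eq_bigr => D _ /=.
  rewrite act_swap; congr (f (act _ _)).
  by elim: n {F} => //= n <-.
by apply: xor_parity => -[[[] []] [[] []]].
Qed.

Lemma tile_parity_north n f : level n f ->
  tile_parity n.+1 (f \o north) = tile_parity n.+1 f.
Proof.
move=> lf; rewrite -[f \o north]/(((f \o swap) \o east) \o swap).
rewrite tile_parity_swap tile_parity_east ?tile_parity_swap //.
by move=> t u /agree_swap; exact: lf.
Qed.

(** * The parity of local functions *)

Definition loc (f : skew_space -> bool) : Prop := exists n, level n f.

(** [xget] picks some level of [f], with default 0 when there is none; by [parityE] any level gives
    the same value. *)
Definition parity (f : skew_space -> bool) : bool :=
  tile_parity (xget 0 [set n | level n f]) f.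

Lemma parityE n f : level n f -> parity f = tile_parity n f.
Proof.
move=> lf; rewrite /parity.
have lx : level (xget 0 [set n | level n f]) f by case: xgetP => [m _ //|/(_ n)].
have stable m k : level m f -> tile_parity (k + m) f = tile_parity m f.
  move=> lm; elim: k => // k IH; rewrite addSn tile_parityS //.
  by apply: level_le lm; rewrite leq_addl.
move: (xget _ _) lx => m lm.
by rewrite -(stable m n) // addnC stable.
Qed.

Lemma loc_addb f g : loc f -> loc g -> loc (fun t => f t (+) g t).
Proof.
move=> [n lf] [m lg]; exists (n + m)%N => t u tu.
by rewrite (lf t u) ?(lg t u) //; apply: agree_le tu; rewrite ?leq_addr ?leq_addl.
Qed.

Lemma loc_andb f g : loc f -> loc g -> loc (fun t => f t && g t).
Proof.
move=> [n lf] [m lg]; exists (n + m)%N => t u tu.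
by rewrite (lf t u) ?(lg t u) //; apply: agree_le tu; rewrite ?leq_addr ?leq_addl.
Qed.

Lemma loc_act f v : loc f -> loc (f \o act v).
Proof.
by move=> [n lf]; exists (`|v.1| + (`|v.2| + n)) => t u /agree_act; exact: lf.
Qed.

Lemma parity_addb f g : loc f -> loc g ->
  parity (fun t => f t (+) g t) = parity f (+) parity g.
Proof.
move=> [n lf] [m lg].
have lf' := level_le (leq_addr m n) lf; have lg' := level_le (leq_addl n m) lg.
rewrite (parityE lf') (parityE lg') (@parityE (n + m)); last first.
  by move=> t u tu; rewrite (lf' t u) ?(lg' t u).
rewrite /tile_parity -big_split; apply: eq_bigr => q _; rewrite -big_split.
by apply: eq_bigr => D _; rewrite -big_split.
Qed.

Lemma parity_false : parity (fun=> false) = false.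
Proof.
rewrite (@parityE 0) // /tile_parity big1 // => q _.
by rewrite big1 // => D _; rewrite big1.
Qed.

Lemma parity_east f : loc f -> parity (f \o east) = parity f.
Proof.
move=> [n lf]; rewrite (@parityE n.+1) ?tile_parity_east // -?parityE //.
  exact: level_le lf.
by move=> t u /agree_east; exact: lf.
Qed.

Lemma parity_north f : loc f -> parity (f \o north) = parity f.
Proof.
move=> [n lf]; rewrite (@parityE n.+1) ?tile_parity_north // -?parityE //.
  exact: level_le lf.
by move=> t u /agree_swap/agree_east/agree_swap; exact: lf.
Qed.

Lemma parity_ziter (f g : skew_space -> skew_space) (v : int -> Z2) :
  (forall m, act (v m) = ziter f g m) -> cancel f g -> cancel g f ->
  (forall h, loc h -> parity (h \o f) = parity h) ->
  forall m h, loc h -> parity (h \o ziter f g m) = parity h.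
Proof.
move=> vE fK gK ph m.
have lz h k : loc h -> loc (h \o ziter f g k) by rewrite -vE; exact: loc_act.
elim/int_rec: m => [//|m IH|m IH] h lh.
  rewrite -(IH _ lh) -[RHS]ph; last exact: lz.
  by congr parity; apply/funext => t /=; rewrite -iterSr.
rewrite -(IH _ lh) -[LHS]ph; last exact: lz.
congr parity; apply/funext => t.
change (h (ziter f g (- m.+1%:Z)%R (ziter f g 1%R t)) = h (ziter f g (- m%:Z)%R t)).
by rewrite -(ziterD fK gK); congr (h (ziter f g _ t)); lia.
Qed.

Lemma parity_act f v : loc f -> parity (f \o act v) = parity f.
Proof.
move=> lf; rewrite -[f \o _]/((f \o ziter east west v.1) \o ziter north south v.2).
have le : loc (f \o ziter east west v.1) by exact: (loc_act (v.1, 0)%R lf).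
rewrite (@parity_ziter _ _ (fun m => (0, m)%R)) //; last exact: parity_north.
- rewrite (@parity_ziter _ _ (fun m => (m, 0)%R)) //; last exact: parity_east.
  + exact: eastK.
  + exact: westK.
- exact: northK.
- exact: southK.
Qed.

(** A tile of level 0 is a single point, so the seeds themselves are counted. *)
Lemma parity_state q : parity (fun t => state_of t == q) = odd (count_mem q seeds).
Proof.
rewrite (@parityE 0) => [|t u /agree0 -> //].
rewrite /tile_parity expn0.
under eq_bigr do rewrite !big_nat1 act0 /= state_of_point.
elim: seeds => [|a s IH]; first by rewrite big_nil.
by rewrite big_cons IH /= oddD oddb.
Qed.

(** * The coinvariant relations, pointwise *)

Lemma count_add_eq (T : Type) (a b c d : pred T) (s : seq T) :
  (forall x, a x + b x = c x + d x) -> count a s + count b s = count c s + count d s.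
Proof. by move=> H; elim: s => //= x s IH; have := H x; lia. Qed.

(** Both sides test whether the vertical letter is j and the label of [t] is g: the labels of [t]
    and [west t] differ by the charge of the letter of [west t]. *)
Lemma state_west t j g :
  (state_of (west t) == (false, j, ladd g (charge false)))
   + (state_of (west t) == (true, j, ladd g (charge true)))
  = (state_of t == (false, j, g)) + (state_of t == (true, j, g)).
Proof.
case: t => [[x y] h]; rewrite /state_of /west; cbn [fst snd].
by case: x.1; case: (vpred x).1; case: y.1 j g h => -[] [[] []] [[] []].
Qed.

Lemma state_south t i g :
  (state_of (south t) == (i, false, ladd g (charge false)))
   + (state_of (south t) == (i, true, ladd g (charge true)))
  = (state_of t == (i, false, g)) + (state_of t == (i, true, g)).
Proof.
case: t => [[x y] h]; rewrite /state_of /south /west /swap; cbn [fst snd].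
by case: y.1; case: (vpred y).1; case: x.1 i g h => -[] [[] []] [[] []].
Qed.

(** * Coding by the Cantor space *)

(** Coordinate 0 holds the state and coordinate k+1 the two edges at depth k, so the skew space
    becomes a full product of finite sets. *)
Definition node (n : nat) : Type := if n is 0 then state else (edge * edge)%type.

Definition node0 n : node n :=
  if n is 0 return node n then (false, false, (false, false)) else (None, None).

HB.instance Definition _ n := gen_eqMixin (node n).
HB.instance Definition _ n := gen_choiceMixin (node n).
HB.instance Definition _ n := isPointed.Build (node n) (node0 n).

Definition dnode (n : nat) := discrete_topology (node n).
HB.instance Definition _ n := DiscreteTopology.on (dnode n).
HB.instance Definition _ n := Pointed.on (dnode n).

Definition branch : Type := tree_of dnode.

Definition branch_point (b : branch) : skew_space :=
  (((b 0 : state).1.1, fun k => (b k.+1 : edge * edge).1),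
   ((b 0 : state).1.2, fun k => (b k.+1 : edge * edge).2), (b 0 : state).2).

Definition point_branch (t : skew_space) : branch :=
  fun n => if n is k.+1 return dnode n then (t.1.1.2 k, t.1.2.2 k) else state_of t.

Lemma branch_pointK : cancel branch_point point_branch.
Proof.
move=> b; apply: functional_extensionality_dep => -[|n] /=.
  by rewrite /state_of /=; case: (b 0) => [[]].
by case: (b n.+1).
Qed.

Lemma point_branchK : cancel point_branch branch_point.
Proof. by move=> [[[i e] [j f]] g]. Qed.

Lemma agree_branch n (b c : branch) : (forall k, k <= n -> b k = c k) ->
  agree n (branch_point b) (branch_point c).
Proof.
move=> bc; rewrite /branch_point; split => /=; last by rewrite bc.
  by split => /=; [rewrite bc | move=> k kn; rewrite bc].
by split => /=; [rewrite bc | move=> k kn; rewrite bc].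
Qed.

Lemma branch_near (b : branch) n : \forall c \near b, forall k, k <= n -> b k = c k.
Proof.
have coord k : \forall c \near b, b k = c k.
  exists (proj k @^-1` [set b k]); split => //.
  suff : @open branch (proj k @^-1` [set b k]) by [].
  apply: open_comp; last exact: discrete_open.
  by move=> + _; exact: proj_continuous.
elim: n => [|n IH].
  by apply: filterS (coord 0) => c bc k; rewrite leqn0 => /eqP ->.
apply: filterS2 IH (coord n.+1) => c IH bc k.
by rewrite leq_eqVlt => /predU1P[->|/IH].
Qed.

(** A countable product of finite discrete spaces with at least two points each is a Cantor space.
    As [skew_space] carries no topology, continuity is expressed through agreement to each depth. *)
Lemma cantor_coding : exists (dec : X -> skew_space) (enc : skew_space -> X),
  [/\ cancel dec enc, cancel enc dec &
      forall n x, \forall y \near x, agree n (dec x) (dec y)].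
Proof.
have fin n : finite_set [set: discrete_topology (dnode n)].
  case: n => [|n].
    exact: (@finite_finset state setT).
  exact: (@finite_finset (edge * edge)%type setT).
have two n : exists xy : dnode n * dnode n, xy.1 != xy.2.
  case: n => [|n].
    exists ((false, false, (false, false)) : state, (true, true, (false, false)) : state).
    by apply/eqP => -[].
  exists ((None, None) : edge * edge, (Some (true, (true, true)), None) : edge * edge).
  by apply/eqP => -[].
have [f [fc _]] := @homeomorphism_cantor_like Rdefinitions.R (tree_of dnode)
  (cantor_like_finite_prod fin two).
have fbij : bijective f by rewrite -setTT_bijective; exact: bij.
have [g fK gK] := fbij.
exists (branch_point \o f), (g \o point_branch); split.
- by move=> x /=; rewrite branch_pointK fK.
- by move=> t /=; rewrite gK point_branchK.
- move=> n x.
  have near_fx : nbhs x (f @^-1` [set c | forall k, k <= n -> f x k = c k]).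
    exact: (fc x _ (branch_near (f x) n)).
  by apply: filterS near_fx => y /=; exact: agree_branch.
Qed.

(** Adding [R] at labels 0 and b gives [12 a] + [12 a+b] = [12 0] + [12 b]; adding [C] at labels 0
    and a gives [12 b] + [12 a+b] = [12 0] + [12 a]. Hence 2 [12 a] = 2 [12 b], and natural numbers
    can be halved. *)
Lemma orbit_count_eq (N : state -> nat) :
  (forall j g, N (false, j, ladd g (charge false)) + N (true, j, ladd g (charge true))
    = N (false, j, g) + N (true, j, g)) ->
  (forall i g, N (i, false, ladd g (charge false)) + N (i, true, ladd g (charge true))
    = N (i, false, g) + N (i, true, g)) ->
  N (false, true, (true, false)) = N (false, true, (false, true)).
Proof.
move=> R C; rewrite /ladd /charge /= in R C.
have := (R true (false, false), R true (false, true),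
         C false (false, false), C false (true, false)) => /=.
move: (N (false, true, (true, false))) (N (false, true, (false, true)))
  (N (false, true, (false, false))) (N (false, true, (true, true)))
  (N (true, true, (false, false))) (N (true, true, (false, true)))
  (N (false, false, (false, false))) (N (false, false, (true, false))).
by clear => ? ? ? ? ? ? ? ? [[[]]]; lia.
Qed.

(** * The action on the Cantor space *)

Section Coding.
Variables (dec : X -> skew_space) (enc : skew_space -> X).
Hypotheses (decK : cancel dec enc) (encK : cancel enc dec).
Hypothesis dec_near : forall n x, \forall y \near x, agree n (dec x) (dec y).

Definition close n (x y : X) : Prop := agree n (dec x) (dec y).

Lemma close_sym n x y : close n x y -> close n y x.
Proof. exact: agree_sym. Qed.

Lemma close_trans n x y z : close n x y -> close n y z -> close n x z.
Proof. exact: agree_trans. Qed.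

Lemma close_le m n x y : m <= n -> close n x y -> close m x y.
Proof. exact: agree_le. Qed.

(** The converse of [dec_near]: each point outside the interior of [U] is separated from [x] at some
    depth, and compactness makes this depth uniform. *)
Lemma nbhs_close x (U : set X) : nbhs x U -> exists n, forall y, close n x y -> U y.
Proof.
move=> /nbhs_interior Ux.
have cK : compact (~` U^°).
  apply: (@subclosed_compact _ _ [set: X]) => //; last exact: cantor_space_compact.
  exact/open_closedC/open_interior.
have [|n _ nP] := (compact_near_coveringP _).1 cK nat \oo (fun n y => ~ close n x y) _.
  move=> y Ky.
  have /existsNP[m Hm] : ~ forall m, close m x y.
    move=> /agree_eq /(can_inj decK) xy; apply: Ky; rewrite -xy.
    exact: nbhs_singleton.
  exists ([set y' | close m y y'], [set n | m <= n]) => /=.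
    by split; [exact: dec_near | exists m].
  move=> [y' n] /= [yy' mn] /(close_le mn) xy'; apply: Hm.
  exact/(close_trans xy')/close_sym.
exists n => y xy; apply: interior_subset; apply: contrapT => Uy.
exact: (nP n (leqnn n) y Uy xy).
Qed.

Lemma close_compact (P : nat -> X -> Prop) :
  (forall m n x, m <= n -> P m x -> P n x) ->
  (forall x, exists n, forall y, close n x y -> P n y) ->
  exists n, forall x, P n x.
Proof.
move=> mono loc.
have [|n _ nP] := (compact_near_coveringP _).1 cantor_space_compact nat \oo P _.
  move=> x _; have [m mP] := loc x.
  exists ([set y | close m x y], [set n | m <= n]) => /=.
    by split; [exact: dec_near | exists m].
  by move=> [y n] /= [xy mn]; apply: mono mn _; exact: mP.
by exists n => x; exact: (nP n (leqnn n) x I).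
Qed.

Lemma close_continuous (g : X -> X) :
  (forall x n, exists m, forall y, close m x y -> close n (g x) (g y)) -> continuous g.
Proof.
move=> H x U /nbhs_close[n nU]; have [m mn] := H x n.
by apply: filterS (dec_near m x) => y xy /=; apply/nU/mn.
Qed.

Lemma continuous_close (g : X -> X) x n : continuous g ->
  exists m, forall y, close m x y -> close n (g x) (g y).
Proof. by move=> /(_ x _ (dec_near n (g x))) /nbhs_close. Qed.

Definition alpha (v : Z2) (x : X) : X := enc (act v (dec x)).

Lemma alphaD v w x : alpha (Z2add v w) x = alpha v (alpha w x).
Proof. by rewrite /alpha encK actD. Qed.

Lemma alphaNK v : cancel (alpha v) (alpha (- v.1, - v.2)%R).
Proof. by move=> x; rewrite /alpha encK actNK decK. Qed.

Lemma alphaKN v : cancel (alpha (- v.1, - v.2)%R) (alpha v).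
Proof. by move=> x; rewrite /alpha encK actKN decK. Qed.

Lemma alpha_continuous v : continuous (alpha v).
Proof.
apply: close_continuous => x n; exists (`|v.1| + (`|v.2| + n))%N => y xy.
by rewrite /close /alpha !encK; exact: agree_act.
Qed.

Lemma alpha_homeo v : homeo (alpha v).
Proof.
split; first exact: alpha_continuous.
exists (alpha (- v.1, - v.2)%R); split; first exact: alpha_continuous.
by split; [exact: alphaNK | exact: alphaKN].
Qed.

Lemma alpha_action : Z2_action alpha.
Proof.
split; first exact: alpha_homeo.
split; first by apply/funext => x; rewrite /alpha act0 decK.
by move=> v w; apply/funext => x; rewrite /= alphaD.
Qed.

Lemma alpha_free : free_action alpha.
Proof.
by move=> v x xv; apply: (@act_free v (dec x)); rewrite -[LHS]encK -/(alpha v x) xv.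
Qed.

Lemma alpha_minimal : minimal_action alpha.
Proof.
move=> x; rewrite -subTset => y _ U /nbhs_close[n nU].
have [v vx] := act_dense n (dec x) (dec y).
exists (alpha v x); split; first by exists v.
by apply/nU/close_sym; rewrite /close /alpha encK.
Qed.

(** * Invariance of the parity under the full group *)

Definition locX (f : X -> bool) : Prop := loc (f \o enc).
Definition parityX (f : X -> bool) : bool := parity (f \o enc).

Lemma locX_close f : (forall x, exists n, forall y, close n x y -> f x = f y) -> locX f.
Proof.
move=> H.
have [m n x mn Hm y xy|x|n nP] :=
    @close_compact (fun n x => forall y, close n x y -> f x = f y).
- by apply: Hm; exact: close_le xy.
- have [n nP] := H x; exists n => y xy z yz.
  by rewrite -(nP y xy) (nP z) //; exact: close_trans yz.
- by exists n => t u tu /=; apply: nP; rewrite /close !encK.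
Qed.

Lemma locX_continuous f g : continuous g -> locX f -> locX (f \o g).
Proof.
move=> gc [n nf]; apply: locX_close => x; have [m mP] := @continuous_close g x n gc.
by exists m => y /mP /nf /=; rewrite !decK.
Qed.

Lemma clopen_locX (A : set X) : clopen A -> locX (fun x => `[< A x >]).
Proof.
move=> [oA cA]; apply: locX_close => x; have [Ax|nAx] := pselect (A x).
  have [n nP] := nbhs_close (open_nbhs_nbhs (conj oA Ax)).
  by exists n => y /nP Ay; rewrite !asboolT.
have [n nP] := nbhs_close (open_nbhs_nbhs (conj (closed_openC cA) nAx)).
by exists n => y /nP Ay; rewrite !asboolF.
Qed.

Lemma locX_addb f g : locX f -> locX g -> locX (fun x => f x (+) g x).
Proof. exact: loc_addb. Qed.

Lemma locX_andb f g : locX f -> locX g -> locX (fun x => f x && g x).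
Proof. exact: loc_andb. Qed.

Lemma parityX_alpha v f : locX f -> parityX (f \o alpha v) = parityX f.
Proof.
move=> lf; rewrite /parityX -(parity_act v lf); congr parity; apply/funext => t /=.
by rewrite /alpha encK.
Qed.

Lemma parityX_big (I : Type) (r : seq I) (F : I -> X -> bool) :
  (forall i, locX (F i)) ->
  parityX (fun x => \big[addb/false]_(i <- r) F i x) =
  \big[addb/false]_(i <- r) parityX (F i).
Proof.
move=> lF.
suff [] : locX (fun x => \big[addb/false]_(i <- r) F i x) /\
  parityX (fun x => \big[addb/false]_(i <- r) F i x) =
  \big[addb/false]_(i <- r) parityX (F i) by [].
elim: r => [|i r [lr pr]].
  split; first by exists 0 => t u _ /=; rewrite !big_nil.
  rewrite big_nil -[RHS]parity_false; congr parity.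
  by apply/funext => t /=; rewrite big_nil.
have -> : (fun x => \big[addb/false]_(j <- i :: r) F j x) =
          (fun x => F i x (+) \big[addb/false]_(j <- r) F j x).
  by apply/funext => x; rewrite big_cons.
split; first exact: locX_addb.
by rewrite big_cons -pr; apply: parity_addb => //; exact: lF.
Qed.

Lemma xor_unique (n : nat) (P : 'I_n -> bool) (i : 'I_n) (b : 'I_n -> bool) :
  P i -> (forall j, P j -> j = i) -> \big[addb/false]_(j < n) (P j && b j) = b i.
Proof.
move=> Pi Pu; rewrite (bigD1 i) //= Pi big1 ?addbF // => j ji.
by case: (boolP (P j)) => // /Pu jE; rewrite jE eqxx in ji.
Qed.

(** Cut along the pieces A i, on each of which [u] is one [alpha (gam i)], and use invariance under
    the action piece by piece. *)
Lemma parityX_full u f : full_group alpha u -> locX f -> parityX (f \o u) = parityX f.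
Proof.
move=> [[uc [w [wc [uK wK]]]] [n [A [gam [[Ac [Ad Au]] uA]]]]] lf.
pose P (i : 'I_n) x := `[< A i x >].
pose v (i : 'I_n) : Z2 := (- (gam i).1, - (gam i).2)%R.
have lP (i : 'I_n) : locX (P i) by apply/clopen_locX/Ac.
have Punique (i j : 'I_n) x : A i x -> P j x -> j = i.
  move=> Aix /asboolP Ajx; apply/eqP/negPn/negP => /eqP ji.
  have : (A j `&` A i) x by [].
  by rewrite Ad // => /ord_inj.
have fuE : f \o u = fun x => \big[addb/false]_(i < n) (P i x && f (alpha (gam i) x)).
  apply/funext => x /=; have [k kn Akx] := Au x.
  rewrite (@xor_unique _ _ (Ordinal kn)) ?(uA k) //; first exact/asboolP.
  by move=> j; exact: Punique.
(* Since [u] is bijective, the images of the pieces also partition X; the image containing y is that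
   of the piece containing [w y]. *)
have fE : f = fun y => \big[addb/false]_(i < n) (P i (alpha (v i) y) && f y).
  apply/funext => y; have [k kn Akx] := Au (w y).
  have yE : y = alpha (gam k) (w y) by rewrite -(uA k) // wK.
  rewrite (@xor_unique _ (fun i => P i (alpha (v i) y)) (Ordinal kn) (fun=> f y)) //.
    by apply/asboolP; rewrite /v /= yE alphaNK.
  move=> j /[dup] Pj /asboolP Aj; apply: (Punique (Ordinal kn) j (w y)) => //=.
  suff -> : w y = alpha (v j) y by [].
  by apply: (can_inj uK); rewrite wK (uA j) // alphaKN.
rewrite fuE [in RHS]fE !parityX_big => [|i|i].
- apply: eq_bigr => i _; rewrite -[RHS](parityX_alpha (gam i)).
    by congr parityX; apply/funext => x /=; rewrite /v alphaNK.
  apply: locX_andb => //; apply: locX_continuous (lP i); exact: alpha_continuous.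
- apply: locX_andb => //; apply: locX_continuous (lP i); exact: alpha_continuous.
- by apply: locX_andb => //; apply: locX_continuous lf; exact: alpha_continuous.
Qed.

(** By freeness, a fixed point in a piece forces the group element of that piece to be zero, so [u]
    is the identity there. Near any other point [u] moves at a visible depth; compactness makes the
    depth uniform. *)
Lemma full_group_fixed u : full_group alpha u ->
  exists n, forall x, close n x (u x) -> u x = x.
Proof.
move=> [[uc _] [n [A [gam [[Ac [_ Au]] uA]]]]].
apply: close_compact => [p q x pq Hp /(close_le pq)//|x].
have [k kn Akx] := Au x; have [fixx|nfix] := pselect (u x = x).
  have [oA _] := Ac k kn.
  have [m mP] := nbhs_close (open_nbhs_nbhs (conj oA Akx)).
  exists m => y /mP Aky _; rewrite (uA k) //.
  have -> : gam k = Z2zero by apply: (@alpha_free _ x); rewrite -uA.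
  by rewrite /alpha act0 decK.
have /existsNP[m Hm] : ~ forall m, close m x (u x).
  by move=> /agree_eq /(can_inj decK) /esym.
have [p pP] := @continuous_close u x m uc.
exists (p + m)%N => y xy yuy; case: Hm.
apply: (@close_trans _ _ y); first by apply: close_le xy; rewrite leq_addl.
apply: (@close_trans _ _ (u y)); first by apply: close_le yuy; rewrite leq_addl.
by apply/close_sym/pP; apply: close_le xy; rewrite leq_addr.
Qed.

(** * Finite subgroups of the full group *)

Lemma locX_all (I : eqType) (r : seq I) (P : I -> X -> bool) :
  (forall i, i \in r -> locX (P i)) -> locX (fun x => all (P^~ x) r).
Proof.
elim: r => [|i r IH] lP; first by exists 0.
apply: locX_andb; first by apply: lP; rewrite mem_head.
by apply: IH => j jr; apply: lP; rewrite in_cons jr orbT.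
Qed.

(** A numerical code of the data of [x] to depth n, used to select a least point in each orbit. *)
Definition key n (x : X) : nat :=
  pickle (state_of (dec x), [seq (dec x).1.1.2 k | k <- iota 0 n],
          [seq (dec x).1.2.2 k | k <- iota 0 n]).

Lemma close_key n x y : close n x y -> key n x = key n y.
Proof.
move=> [[a b] [c d] e]; rewrite /key /state_of a c e; congr (pickle (_, _, _)).
  by apply/eq_in_map => k; rewrite mem_iota => /b.
by apply/eq_in_map => k; rewrite mem_iota => /d.
Qed.

Lemma key_close n x y : key n x = key n y -> close n x y.
Proof.
move=> /(pcan_inj pickleK) [a c e b d].
split => //; split => // k kn.
  by have := congr1 (nth None ^~ k) b; rewrite /= !(nth_map 0) ?size_iota // !nth_iota.
by have := congr1 (nth None ^~ k) d; rewrite /= !(nth_map 0) ?size_iota // !nth_iota.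
Qed.

Lemma locX_key_le n (u : X -> X) : continuous u -> locX (fun x => key n x <= key n (u x)).
Proof.
move=> uc; apply: locX_close => x; have [m mP] := @continuous_close u x n uc.
exists (n + m)%N => y xy.
rewrite (@close_key n x y); last by apply: close_le xy; rewrite leq_addr.
by rewrite (@close_key n (u x) (u y)) //; apply: mP; apply: close_le xy; rewrite leq_addl.
Qed.

Lemma full_continuous u : full_group alpha u -> continuous u.
Proof. by move=> [[]]. Qed.

(** Coincidence of [u] and [w] means being fixed by [q \o u], a condition that is open by
    [full_group_fixed]. *)
Lemma locX_eq (u w : X -> X) : continuous u -> continuous w ->
  (exists q, [/\ full_group alpha q, cancel w q & cancel q w] /\ full_group alpha (q \o u)) ->
  locX (fun x => u x == w x).
Proof.
move=> uc wc [q [[fq wK qK] fqu]]; apply: locX_close => x.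
have [uw|uw] := eqVneq (u x) (w x).
  have [n nP] := full_group_fixed fqu.
  have [m mP] := @continuous_close (q \o u) x n (full_continuous fqu).
  exists (n + m)%N => y xy; apply/esym/eqP/(can_inj qK); rewrite wK.
  apply: (nP y); apply: (@close_trans _ _ x).
    by apply/close_sym; apply: close_le xy; rewrite leq_addr.
  have qux : (q \o u) x = x by rewrite /= uw wK.
  by rewrite -{1}qux; apply: mP; apply: close_le xy; rewrite leq_addl.
have /existsNP[n Hn] : ~ forall n, close n (u x) (w x).
  by move=> /agree_eq /(can_inj decK) /eqP; apply/negP.
have [m mP] := @continuous_close u x n uc; have [p pP] := @continuous_close w x n wc.
exists (m + p)%N => y xy; apply/esym/negbTE/eqP => uwy; apply: Hn.
apply: (@close_trans _ _ (u y)); first by apply: mP; apply: close_le xy; rewrite leq_addr.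
by rewrite uwy; apply/close_sym/pP; apply: close_le xy; rewrite leq_addl.
Qed.

Definition orbit_seq (us : seq (X -> X)) (x : X) : seq X := undup [seq u x | u <- us].

(** Selects the last index attaining each orbit point, as [undup] does, so that every point is
    counted once. *)
Definition fresh (us : seq (X -> X)) (k : nat) (x : X) : bool :=
  nth id us k x \notin [seq u x | u <- drop k.+1 us].

Lemma xor_fresh us (S : X -> bool) x :
  \big[addb/false]_(k < size us) (fresh us k x && S (nth id us k x)) =
  odd (count S (orbit_seq us x)).
Proof.
elim: us => [|u us IH]; first by rewrite big_ord0.
rewrite big_ord_recl /= {}IH /fresh /= drop0 /orbit_seq /=.
by case: ifP => //= _; rewrite oddD oddb.
Qed.

Section FiniteGroup.
Variables (F : set (X -> X)) (us : seq (X -> X)).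
Hypotheses (Fgroup : is_subgroup F) (Ffull : F `<=` full_group alpha).
Hypothesis Fus : forall u, F u <-> u \in us.

Lemma inverse_in u : F u -> exists w, [/\ F w, cancel u w & cancel w u].
Proof. by case: Fgroup => _ [_ +] => /[apply] -[w Fw [uw wu]]; exists w. Qed.

Lemma locX_fresh k : k < size us -> locX (fresh us k).
Proof.
move=> kn; set w := nth id us k.
have Fw : F w by apply/Fus/mem_nth.
have [q [Fq wK qK]] := inverse_in Fw.
have -> : fresh us k = fun x => all (fun u => ~~ (u x == w x)) (drop k.+1 us).
  apply/funext => x; rewrite /fresh -/w.
  by elim: (drop _ _) => //= u s <-; rewrite in_cons negb_or eq_sym.
apply: (@locX_all _ _ (fun u x => ~~ (u x == w x))) => u /mem_drop /Fus Fu.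
have [n nP] : locX (fun x => u x == w x).
  apply: locX_eq; [exact/full_continuous/Ffull|exact/full_continuous/Ffull|].
  exists q; split; first by split => //; exact: Ffull.
  by apply: Ffull; case: Fgroup => _ [+ _]; apply.
by exists n => x y /nP /= ->.
Qed.

Lemma separating_level : exists n, forall u x, u \in us -> close n x (u x) -> u x = x.
Proof.
have : forall u, u \in us -> full_group alpha u by move=> u /Fus /Ffull.
elim: us => [|u s IH] fs; first by exists 0.
have [|n nP] := IH; first by move=> w ws; apply: fs; rewrite in_cons ws orbT.
have [m mP] := full_group_fixed (fs u (mem_head _ _)).
exists (n + m)%N => w x; rewrite in_cons => /predU1P[->|ws] xwx.
  by apply: mP; apply: close_le xwx; rewrite leq_addl.
by apply: nP => //; apply: close_le xwx; rewrite leq_addr.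
Qed.

(** A finite group in the full group has a clopen transversal [D]. Moving the part of [S] in each
    orbit onto the representative in [D] preserves parity and leaves the number of moved points
    modulo 2. *)
Lemma orbit_parity : exists D : X -> bool, forall S, locX S ->
  locX (fun x => D x && odd (count S (orbit_seq us x))) /\
  parityX S = parityX (fun x => D x && odd (count S (orbit_seq us x))).
Proof.
have [M MP] := separating_level.
(* [D] picks the point of least key in each orbit. *)
pose D x := all (fun u => key M x <= key M (u x)) us.
have Dmin x u : D x -> F u -> key M x <= key M (u x).
  by move=> /allP Dx /Fus /Dx.
have Dex y : exists u, F u /\ D (u y).
  pose P m := has (fun u => key M (u y) == m) us.
  have [F1 [Fcomp Finv]] := Fgroup.
  have exP : exists m, P m.
    by exists (key M y); apply/hasP; exists id; [exact/Fus | exact/eqP].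
  have [m /hasP[u /Fus Fu /eqP um] mmin] := ex_minnP exP.
  exists u; split => //; apply/allP => w /Fus Fw; rewrite um; apply: mmin.
  by apply/hasP; exists (w \o u); [apply/Fus/Fcomp | exact/eqP].
(* Two least points of one orbit have equal keys, hence agree to depth M, and [MP] makes them
   equal. *)
have Duniq x u : D x -> F u -> D (u x) -> u x = x.
  move=> Dx Fu Dux; have [w [Fw uw wu]] := inverse_in Fu.
  apply: MP; first exact/Fus.
  apply: key_close; apply/eqP; rewrite eqn_leq Dmin //=.
  by have := Dmin _ _ Dux Fw; rewrite uw.
have lD : locX D.
  apply: (@locX_all _ _ (fun u x => key M x <= key M (u x))) => u /Fus /Ffull fu.
  exact/locX_key_le/full_continuous.
have /choice[inv invP] (k : 'I_(size us)) : exists w,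
    [/\ F w, cancel (nth id us k) w & cancel w (nth id us k)].
  by apply: inverse_in; apply/Fus/mem_nth.
have Fnth (k : 'I_(size us)) : F (nth id us k) by apply/Fus/mem_nth.
exists D => S lS.
have DE : (fun x => D x && odd (count S (orbit_seq us x))) =
    fun x => \big[addb/false]_(k < size us)
      (S (nth id us k x) && (D x && fresh us k x)).
  apply/funext => x; rewrite -xor_fresh big_distrr /=.
  by apply: eq_bigr => k _; rewrite andbA [RHS]andbC.
have lDf (k : 'I_(size us)) : locX (fun x => D x && fresh us k x).
  by apply: locX_andb => //; exact: locX_fresh.
(* Each y is reached exactly once from [D]: from the representative z of its orbit, by the unique
   fresh index sending z to y. *)
have SE : S = fun y => \big[addb/false]_(k < size us)
    (S y && (D (inv k y) && fresh us k (inv k y))).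
  apply/funext => y; rewrite -big_distrr /=.
  have [w [Fw Dw]] := Dex y; set z := w y in Dw.
  have [v [Fv wv vw]] := inverse_in Fw.
  have zy : v z = y by rewrite /z wv.
  have -> : \big[addb/false]_(k < size us) (D (inv k y) && fresh us k (inv k y)) =
      \big[addb/false]_(k < size us) (fresh us k z && (nth id us k z == y)).
    apply: eq_bigr => k _; have [Fi ki ik] := invP k.
    have [kz|nkz] := eqVneq (nth id us k z) y; first by rewrite -kz ki Dw andbT.
    rewrite andbF; apply/negbTE; apply/negP => /andP[Dk _].
    move/eqP: nkz; apply; rewrite -[RHS]ik; congr (nth id us k _).
    have := @Duniq z (inv k \o v) Dw; rewrite /= zy => -> //.
    by case: Fgroup => _ [+ _]; apply.
  rewrite (xor_fresh us (pred1 y) z) count_uniq_mem ?undup_uniq //.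
  suff -> : y \in orbit_seq us z by rewrite andbT.
  by rewrite mem_undup; apply/mapP; exists v => //; exact/Fus.
have lE (k : 'I_(size us)) : locX (fun x => D (inv k x) && fresh us k (inv k x)).
  have [Fi _ _] := invP k.
  by apply: (@locX_continuous _ (inv k)) (lDf k); exact/full_continuous/Ffull.
have lSk (k : 'I_(size us)) : locX (fun x => S (nth id us k x)).
  by apply: (@locX_continuous _ (nth id us k)) lS; exact/full_continuous/Ffull.
split.
  rewrite DE; elim: (index_enum _) => [|k r IH].
    by exists 0 => t u _ /=; rewrite !big_nil.
  have [n nP] := locX_addb (locX_andb (lSk k) (lDf k)) IH.
  by exists n => t u /nP /=; rewrite !big_cons.
rewrite DE [in LHS]SE !parityX_big => [|k|k]; last 2 first.
- exact: locX_andb.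
- exact: locX_andb.
(* The k-th piece of [S] is carried back into [D] by its own group element, under which parity is
   invariant. *)
apply: eq_bigr => k _; have [Fi ki ik] := invP k.
rewrite -(@parityX_full (nth id us k)); last exact: locX_andb.
  by congr parityX; apply/funext => x /=; rewrite ki.
exact: Ffull.
Qed.

Lemma parityX_orbit S S' : locX S -> locX S' ->
  (forall x, count S (orbit_seq us x) = count S' (orbit_seq us x)) -> parityX S = parityX S'.
Proof.
move=> lS lS' SS'; have [D DP] := orbit_parity.
rewrite (DP S lS).2 (DP S' lS').2; congr parityX; apply/funext => x.
by rewrite SS'.
Qed.

Lemma count_orbit S u x : F u -> count (S \o u) (orbit_seq us x) = count S (orbit_seq us x).
Proof.
move=> Fu; have [w [Fw uw wu]] := inverse_in Fu.
have [_ [Fcomp _]] := Fgroup.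
rewrite -count_map; apply/permP; apply: uniq_perm.
- by rewrite (map_inj_uniq (can_inj uw)) undup_uniq.
- exact: undup_uniq.
move=> y; rewrite mem_undup; apply/mapP/mapP.
  move=> [z]; rewrite mem_undup => /mapP[v /Fus Fv ->] ->.
  by exists (u \o v) => //; apply/Fus/Fcomp.
move=> [v /Fus Fv ->]; exists (w (v x)); last by rewrite wu.
by rewrite mem_undup; apply/mapP; exists (w \o v) => //; apply/Fus/Fcomp.
Qed.

End FiniteGroup.

(** * The contradiction from a dense locally finite subgroup *)

Lemma clopen_state q : clopen [set x | state_of (dec x) = q].
Proof.
have near_state x : \forall y \near x, state_of (dec x) = state_of (dec y).
  by apply: filterS (dec_near 0 x) => y /agree0.
split.
  rewrite openE => x /= xq; apply: filterS (near_state x) => y xy /=.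
  by rewrite -xq -xy.
rewrite -openC openE => x /= nq; apply: filterS (near_state x) => y xy /= yq.
by apply: nq; rewrite xy.
Qed.

Lemma full_alpha v : full_group alpha (alpha v).
Proof.
split; first exact: alpha_homeo.
exists 1, (fun=> setT), (fun=> v); split; last by [].
split; first by move=> i _; exact: clopenT.
split; last by move=> x; exists 0.
by move=> [|i] [|j].
Qed.

(** Density for the partition by states gives [h] moving every state set exactly as [alpha v]
    does. *)
Lemma dense_approx H v : dense_in_full_group alpha H -> exists2 h, H h &
  forall x, state_of (act (- v.1, - v.2)%R (dec (h x))) = state_of (dec x).
Proof.
move=> dH; pose q0 : state := (false, false, (false, false)).
pose A i : set X := [set x | state_of (dec x) = nth q0 (enum {: state}) i].
have [|h Hh hA] := dH _ (full_alpha v) #|{: state}| A.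
  split; first by move=> i _; exact: clopen_state.
  split.
    move=> i j ilt jlt ij; rewrite -subset0 => x [/= xi xj]; apply: ij; apply/eqP.
    by rewrite -(@nth_uniq _ q0 (enum {: state})) -?cardE ?enum_uniq // -xi xj.
  move=> x; exists (index (state_of (dec x)) (enum {: state})).
    by rewrite cardE index_mem mem_enum.
  by rewrite /A /= nth_index ?mem_enum.
exists h => // x; set i := index (state_of (dec x)) (enum {: state}).
have Ax : A i x by rewrite /A /= nth_index ?mem_enum.
have : (h @` A i) (h x) by exists x.
rewrite hA; last by rewrite cardE index_mem mem_enum.
move=> [y Ay <-]; rewrite /alpha encK actNK.
by rewrite Ay Ax.
Qed.

Lemma not_dense_locally_finite H : is_subgroup H -> H `<=` full_group alpha ->
  dense_in_full_group alpha H -> ~ locally_finite H.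
Proof.
move=> Hgroup Hfull Hdense Hlf.
have [h1 Hh1 st1] := dense_approx (1, 0)%R Hdense.
have [h2 Hh2 st2] := dense_approx (0, 1)%R Hdense.
pose s i := if i is 0 then h1 else h2.
pose F := gen_subgroup 2 s.
have /finite_seqP[us FE] : finite_set F by apply: Hlf => -[|[|]].
have Fgroup : is_subgroup F.
  split; first by move=> K [].
  split; first by move=> f g Ff Fg K KG Ks; case: (KG) => _ [+ _]; apply; [exact: Ff|exact: Fg].
  (* Inverses are unique, so the inverse found in [H] is the one lying in every subgroup [K] that
     contains the generators. *)
  move=> f Ff; have [_ [_ /(_ f (Ff H Hgroup _))]] := Hgroup.
  case=> [[|[|]]//|g Hg [fg gf]]; exists g => // K KG Ks.
  have [_ [_ /(_ f (Ff K KG Ks))[g' Kg' [fg' g'f]]]] := KG.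
  suff -> : g = g' by [].
  by apply/funext => x; rewrite -[x in LHS]g'f fg.
have FH : F `<=` H by move=> f; apply => // -[|[|]].
have Ffull : F `<=` full_group alpha by move=> f /FH /Hfull.
have Fus u : F u <-> u \in us by rewrite FE.
have F1 : F h1 by move=> K _ Ks; exact: (Ks 0).
have F2 : F h2 by move=> K _ Ks; exact: (Ks 1).
pose N q x := count (fun w => state_of (dec w) == q) (orbit_seq us x).
(* On states, [h1] followed by [west] changes nothing, while [h1] permutes each orbit. *)
have Nwest q x : N q x = count (fun w => state_of (west (dec w)) == q) (orbit_seq us x).
  rewrite -[RHS](count_orbit Fgroup Fus _ _ F1); apply: eq_count => w /=.
  by rewrite -(st1 w).
have Nsouth q x : N q x = count (fun w => state_of (south (dec w)) == q) (orbit_seq us x).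
  rewrite -[RHS](count_orbit Fgroup Fus _ _ F2); apply: eq_count => w /=.
  by rewrite -(st2 w).
have rows x j g : N (false, j, ladd g (charge false)) x + N (true, j, ladd g (charge true)) x
    = N (false, j, g) x + N (true, j, g) x.
  by rewrite ![N (_, j, ladd _ _) x]Nwest; apply: count_add_eq => w; exact: state_west.
have cols x i g : N (i, false, ladd g (charge false)) x + N (i, true, ladd g (charge true)) x
    = N (i, false, g) x + N (i, true, g) x.
  by rewrite ![N (i, _, ladd _ _) x]Nsouth; apply: count_add_eq => w; exact: state_south.
have eqN x : N (false, true, (true, false)) x = N (false, true, (false, true)) x.
  exact: (@orbit_count_eq (N^~ x)).
have lstate q : locX (fun x => state_of (dec x) == q).
  by exists 0 => t u /agree0 /=; rewrite !encK => ->.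
have pstate q : parityX (fun x => state_of (dec x) == q) = odd (count_mem q seeds).
  rewrite -parity_state /parityX; congr parity.
  by apply/funext => t /=; rewrite encK.
(* Equal counts on orbits force equal parities, but [seeds] contains (1,2,b) once and (1,2,a) not at
   all. *)
have := parityX_orbit Fgroup Ffull Fus
  (lstate (false, true, (true, false))) (lstate (false, true, (false, true))) eqN.
by rewrite !pstate.
Qed.

End Coding.

Theorem theoremt :
  exists alpha : Z2 -> X -> X,
    Z2_action alpha /\ free_action alpha /\ minimal_action alpha /\
    ~ (exists H : set (X -> X),
         is_subgroup H /\ H `<=` full_group alpha /\
         dense_in_full_group alpha H /\ locally_finite H).
Proof.
have [dec [enc [decK encK dec_near]]] := cantor_coding.
exists (alpha dec enc); split; first exact: alpha_action.
split; first exact: alpha_free.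
split; first exact: alpha_minimal.
by move=> [H [Hg [Hf [Hd]]]]; exact: not_dense_locally_finite Hd.
Qed.
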